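(* Let $A$ be a finite dimensional $C^*$-algebra. Suppose that $E$ and $F$ are unital Banach right $A$-modules. If $\theta:E\to F$ is a local $\mathbb{C}$-linear map (not assumed to be bounded), then $\theta$ is an $A$-module map.
   Context: A linear map $\theta:E\to F$ between Banach right $A$-modules is local if $\theta(e)a=0$ whenever $e\in E$ and $a\in A$ satisfy $ea=0$. *)

(* Defs.v *)
From HB Require Import structures.
From mathcomp Require Import all_boot all_order all_algebra.
From mathcomp Require Import complex.
From mathcomp Require Import boolp classical_sets reals topology normedtype.

Set Implicit Arguments.
Unset Strict Implicit.
Unset Printing Implicit Defensive.

Import Order.TTheory GRing.Theory Num.Theory.
Import numFieldNormedType.Exports.

Declare Scope banach_scope.
Delimit Scope banach_scope with B.

Local Open Scope ring_scope.
Local Open Scope complex_scope.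

(* Complex Banach spaces are [completeNormedModType R[i]], with [R] the reals.
   The norm takes its values in [R[i]]; they are real and nonnegative, and the
   order of [R[i]] restricts to the usual order on the real axis. *)

(* MathComp's algebras have a unit distinct from 0. Banach algebras and
   C*-algebras here need not have a unit, and may be zero. *)
HB.mixin Record isBanachAlgebra (R : realType) A
    of CompleteNormedModule R[i] A := {
  amul : A -> A -> A;
  amulA : associative amul;
  amulDl : left_distributive amul +%R;
  amulDr : right_distributive amul +%R;
  amulZl : forall (c : R[i]) (a b : A), amul (c *: a) b = c *: amul a b;
  amulZr : forall (c : R[i]) (a b : A), amul a (c *: b) = c *: amul a b;
  amul_norm : forall a b : A, `|amul a b| <= `|a| * `|b|
}.

#[short(type="banachAlgType")]
HB.structure Definition BanachAlgebra (R : realType) :=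
  {A of CompleteNormedModule R[i] A & isBanachAlgebra R A}.

Notation "a ** b" := (amul a b) (at level 40, left associativity)
  : banach_scope.
Local Open Scope banach_scope.

HB.mixin Record BanachAlgebra_isCstar (R : realType) A of BanachAlgebra R A := {
  star : A -> A;
  starK : involutive star;
  starD : forall a b : A, star (a + b) = star a + star b;
  starZ : forall (c : R[i]) (a : A), star (c *: a) = Num.conj c *: star a;
  starM : forall a b : A, star (a ** b) = star b ** star a;
  star_norm : forall a : A, `|star a ** a| = `|a| ^+ 2
}.

#[short(type="cstarAlgType")]
HB.structure Definition CstarAlgebra (R : realType) :=
  {A of BanachAlgebra R A & BanachAlgebra_isCstar R A}.

Definition finite_dimensional (K : pzRingType) (V : lmodType K) : Prop :=
  exists (n : nat) (b : 'I_n -> V),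
    forall v : V, exists c : 'I_n -> K, v = \sum_(i < n) c i *: b i.

(* The action is only required to be jointly continuous; an action with
   [`|ract x a| <= `|x| * `|a|] is the case [M = 1]. *)
HB.mixin Record isBanachRightModule (R : realType) (A : banachAlgType R) E
    of CompleteNormedModule R[i] E := {
  ract : E -> A -> E;
  ractA : forall (x : E) (a b : A), ract x (a ** b) = ract (ract x a) b;
  ractDl : forall (x y : E) (a : A), ract (x + y) a = ract x a + ract y a;
  ractDr : forall (x : E) (a b : A), ract x (a + b) = ract x a + ract x b;
  ractZl : forall (c : R[i]) (x : E) (a : A), ract (c *: x) a = c *: ract x a;
  ractZr : forall (c : R[i]) (x : E) (a : A), ract x (c *: a) = c *: ract x a;
  ract_norm : exists M : R[i],
    forall (x : E) (a : A), `|ract x a| <= M * `|x| * `|a|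
}.

#[short(type="banachRightModType")]
HB.structure Definition BanachRightModule (R : realType) (A : banachAlgType R) :=
  {E of CompleteNormedModule R[i] E & isBanachRightModule R A E}.

Notation "x <* a" := (ract x a) (at level 40, left associativity)
  : banach_scope.

Definition is_identity (R : realType) (A : banachAlgType R) (u : A) : Prop :=
  left_id u (@amul R A) /\ right_id u (@amul R A).

Definition unital_module (R : realType) (A : banachAlgType R)
    (E : banachRightModType A) : Prop :=
  exists2 u : A, is_identity u & forall x : E, x <* u = x.

Definition is_local (R : realType) (A : banachAlgType R)
    (E F : banachRightModType A) (theta : E -> F) : Prop :=
  forall (e : E) (a : A), e <* a = 0 -> theta e <* a = 0.

(* Compatibility with the action only: additivity is part of the type of the
   maps to which this is applied. *)
Definition module_map (R : realType) (A : banachAlgType R)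
    (E F : banachRightModType A) (theta : {linear E -> F}) : Prop :=
  forall (e : E) (a : A), theta (e <* a) = theta e <* a.

(* Main.v *)
Require Import Defs.
From mathcomp Require Import all_boot all_order all_algebra.
From mathcomp Require Import complex.
From mathcomp Require Import boolp classical_sets reals topology normedtype.
Local Open Scope ring_scope.

(** A local map satisfies [theta (e a) = theta e a] whenever [e] is an
    eigenvector of [a].  For self-adjoint [a], some nonzero polynomial [p]
    kills [a] because [A] is finite dimensional.  Right multiplication by [a]
    has no Jordan blocks: [x (a - z)^2 = 0] forces [x (a - z) = 0] by the
    C*-identity.  So, peeling off the roots of [p] one at a time, the identity
    of [A] is a sum of eigenvectors of [a], and hence so is every [e].  General
    elements are combinations of two self-adjoint ones. *)

Import Order.TTheory GRing.Theory Num.Theory.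
Local Open Scope complex_scope.
Local Open Scope banach_scope.

Lemma size_mul_XsubC (K : idomainType) (q : {poly K}) (z : K) :
  q != 0 -> size (q * ('X - z%:P))%R = (size q).+1.
Proof.
by move=> q0; rewrite size_Mmonic ?monicXsubC // size_XsubC addn2.
Qed.

Section BanachAlgebra.
Context {R : realType} {A : banachAlgType R}.
Implicit Types (a b x y u v : A) (c z : R[i]) (p q : {poly R[i]}).

Lemma amul0l a : 0 ** a = 0.
Proof. by have := amulZl 0 0 a; rewrite !scale0r. Qed.

Lemma amul0r a : a ** 0 = 0.
Proof. by have := amulZr 0 a 0; rewrite !scale0r. Qed.

Lemma amulNl a b : (- a) ** b = - (a ** b).
Proof. by rewrite -scaleN1r amulZl scaleN1r. Qed.

Lemma amulNr a b : a ** (- b) = - (a ** b).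
Proof. by rewrite -scaleN1r amulZr scaleN1r. Qed.

Lemma amulBl a b x : (a - b) ** x = a ** x - b ** x.
Proof. by rewrite amulDl amulNl. Qed.

Lemma amulBr a b x : x ** (a - b) = x ** a - x ** b.
Proof. by rewrite amulDr amulNr. Qed.

Lemma amul_suml (I : finType) (f : I -> A) a :
  (\sum_i f i) ** a = \sum_i f i ** a.
Proof.
apply: (big_ind2 (fun s t => s ** a = t)) => [|x1 x2 y1 y2 <- <-|//].
  exact: amul0l.
exact: amulDl.
Qed.

Lemma is_identity_uniq u v : is_identity u -> is_identity v -> u = v.
Proof. by move=> [ul _] [_ vr]; rewrite -[LHS]vr ul. Qed.

(* The product [x p(a)], which makes sense even if [A] has no identity. *)
Definition mulpoly a p x : A :=
  \sum_(i < size p) p`_i *: iter i (fun y => y ** a) x.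

Lemma mulpoly_widen n a p x : (size p <= n)%N ->
  mulpoly a p x = \sum_(i < n) p`_i *: iter i (fun y => y ** a) x.
Proof.
move=> le_pn; rewrite /mulpoly.
rewrite (big_ord_widen n (fun i => p`_i *: iter i (fun y => y ** a) x)) //.
rewrite big_mkcond; apply: eq_bigr => i _.
by case: ltnP => // le_pi; rewrite nth_default // scale0r.
Qed.

Lemma mulpolyC a c x : mulpoly a c%:P x = c *: x.
Proof.
by rewrite (@mulpoly_widen 1) ?size_polyC_leq1 // big_ord1 coefC.
Qed.

Lemma mulpoly_XsubC a z q x :
  mulpoly a (q * ('X - z%:P)) x = mulpoly a q x ** a - z *: mulpoly a q x.
Proof.
have [->|q0] := eqVneq q 0.
  by rewrite mul0r -[0]/(0%:P) !mulpolyC !scale0r amul0l scaler0 subr0.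
have le_q : (size (q * ('X - z%:P))%R <= (size q).+1)%N.
  by rewrite size_mul_XsubC.
rewrite (mulpoly_widen _ _ _ _ le_q) {2}(@mulpoly_widen (size q).+1) //.
(* The factor ['X] shifts indices: the term 0 vanishes, and term [i.+1] carries one more right
   multiplication by [a]. *)
have -> : mulpoly a q x ** a =
    \sum_(i < (size q).+1) (q * 'X)`_i *: iter i (fun y => y ** a) x.
  rewrite big_ord_recl coefMX scale0r add0r amul_suml.
  by apply: eq_bigr => i _; rewrite coefMX amulZl.
rewrite scaler_sumr -sumrB; apply: eq_bigr => i _.
by rewrite scalerA -scalerBl mulrBr coefB coefMC mulrC [z * _]mulrC.
Qed.

Lemma mulpolyZB a p c x y :
  mulpoly a p (x - c *: y) = mulpoly a p x - c *: mulpoly a p y.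
Proof.
rewrite scaler_sumr -sumrB; apply: eq_bigr => i _.
rewrite scalerA mulrC -scalerA -scalerBr; congr (_ *: _).
by elim: (i : nat) => //= n ->; rewrite amulBl amulZl.
Qed.

Lemma mulpoly_eigen a p z x : x ** a = z *: x -> mulpoly a p x = p.[z] *: x.
Proof.
move=> xa; rewrite horner_coef scaler_suml; apply: eq_bigr => i _.
rewrite -scalerA; congr (_ *: _).
elim: (i : nat) => [|n /= ->]; first by rewrite expr0 scale1r.
by rewrite amulZl xa scalerA exprSr.
Qed.

(** If [n] vectors span [A], the [n.+1] vectors x, xa, ..., xa^n are linearly dependent. A nonzero
    row in the left kernel of their coordinate matrix lists the coefficients of [p]. *)
Lemma mulpoly_annihilator (fdA : finite_dimensional A) a x :
  exists2 p, p != 0 & mulpoly a p x = 0.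
Proof.
have [n [b spanb]] := fdA.
have [f fE] := choice (fun i : 'I_n.+1 => spanb (iter i (fun y => y ** a) x)).
pose M := \matrix_(i < n.+1, j < n) f i j.
have : kermx M != 0.
  by rewrite kermx_eq0 /row_free neq_ltn ltnS rank_leq_col.
case/rowV0Pn => v /sub_kermxP vM v0.
exists (rVpoly v).
  by apply: contra_neq v0 => pv; rewrite -[v]rVpolyK pv linear0.
rewrite (mulpoly_widen _ _ _ _ (size_poly _ _)).
under eq_bigr => i _ do rewrite coef_rVpoly_ord fE scaler_sumr.
rewrite exchange_big big1 // => j _.
under eq_bigr => i _ do rewrite scalerA.
rewrite -scaler_suml; have /rowP/(_ j) := vM; rewrite !mxE => vMj.
(* The coordinates are turned back into matrix entries, to match the sum in [vMj]. *)
under eq_bigr => i _ do rewrite -[f i j](mxE matrix_key (fun i j => f i j) i j).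
by rewrite vMj scale0r.
Qed.

End BanachAlgebra.

Section CstarAlgebra.
Context {R : realType} {A : cstarAlgType R}.
Implicit Types (a x y : A) (z : R[i]).

Lemma starB a x : star (a - x) = star a - star x.
Proof. by rewrite starD -scaleN1r starZ rmorphN1 scaleN1r. Qed.

(** The C*-identity applied to [star y] makes the norm of [star y] zero. *)
Lemma amul_star_eq0 y : y ** star y = 0 -> y = 0.
Proof.
move=> yy; apply: (can_inj starK); apply/eqP.
have -> : star (0 : A) = 0 by rewrite -(subrr y) starB !subrr.
by rewrite -normr_eq0 -sqrf_eq0 -star_norm starK yy normr0.
Qed.

(** In both cases below y y* = 0. Since y a y* = z y y* is self-adjoint, this is clear unless [z] is
    real. For real [z], y* = (a - z) x*, and [y] is killed by a - z. *)
Lemma sa_eigen_square a x y z : star a = a ->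
  y = x ** a - z *: x -> y ** a = z *: y -> y = 0.
Proof.
move=> saa yE ya.
have zyy : z *: (y ** star y) = Num.conj z *: (y ** star y).
  have : star (y ** a ** star y) = y ** a ** star y.
    by rewrite !starM starK saa amulA.
  by rewrite ya amulZl starZ starM starK.
have [zz|zz] := eqVneq z (Num.conj z); last first.
  apply: amul_star_eq0; apply/eqP; move/eqP: zyy.
  by rewrite -subr_eq0 -scalerBl scaler_eq0 subr_eq0 (negPf zz).
apply: amul_star_eq0; rewrite {2}yE starB starM starZ saa -zz.
by rewrite amulBr amulA ya amulZl amulZr subrr.
Qed.

Lemma cartesian_decomposition a :
  exists c d : R[i], exists b1 b2 : A,
    [/\ star b1 = b1, star b2 = b2 & a = c *: b1 + d *: b2].
Proof.
(* These are twice the real part of [a] and minus twice its imaginary part. *)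
exists 2^-1, (- ('i / 2)), (a + star a), ('i *: (a - star a)); split.
- by rewrite starD starK addrC.
- by rewrite starZ starB starK conjCi scaleNr -scalerN opprB.
rewrite scalerA.
have -> : - ('i / 2) * 'i = 2^-1 :> R[i].
  by rewrite mulNr mulrAC -expr2 sqrCi mulN1r opprK.
rewrite -scalerDr addrACA subrr addr0 -mulr2n -[a *+ 2]scaler_nat scalerA.
by rewrite mulVf ?scale1r // pnatr_eq0.
Qed.

End CstarAlgebra.

Section LocalMap.
Context {R : realType} {A : cstarAlgType R} {E F : banachRightModType A}.
Variables (theta : {linear E -> F}) (u : A).
Hypotheses (localtheta : is_local theta) (idu : is_identity u).
Hypotheses (uE : forall e : E, e <* u = e) (uF : forall f : F, f <* u = f).

Lemma ractB_scalar (G : banachRightModType A) (g : G) (a : A) (z : R[i]) :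
  g <* u = g -> g <* (a - z *: u) = g <* a - z *: g.
Proof. by move=> gu; rewrite ractDr -scaleNr ractZr gu scaleNr. Qed.

(** Locality is applied to [a - z *: u], which annihilates [e]. *)
Lemma local_eigen (e : E) (a : A) (z : R[i]) :
  e <* a = z *: e -> theta (e <* a) = theta e <* a.
Proof.
move=> ea; have /localtheta : e <* (a - z *: u) = 0.
  by rewrite ractB_scalar // ea subrr.
by rewrite ractB_scalar // => /eqP; rewrite subr_eq0 ea linearZ => /eqP.
Qed.

(** Induction on the degree of [p]. The vector [x] stays general because the induction step replaces
    it. *)
Lemma local_mulpoly (a : A) : star a = a ->
  forall (p : {poly R[i]}) (x : A), p != 0 -> mulpoly a p x = 0 ->
  forall e : E, theta ((e <* x) <* a) = theta (e <* x) <* a.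
Proof.
move=> saa p; have [n] := ubnP (size p).
elim: n p => // n IHn p; rewrite ltnS => le_pn x p0 px e.
have [p1|/closed_rootP[z /factor_theorem[q pE]]] := eqVneq (size p) 1%N.
  (* A nonzero constant kills only x = 0, so 0 serves as eigenvalue. *)
  have /size_poly1P[c c0 pc] : size p == 1%N by rewrite p1.
  apply: (@local_eigen _ _ 0).
  move/eqP: px; rewrite pc mulpolyC scaler_eq0 (negPf c0) => /eqP->.
  have -> : e <* 0 = 0 by have := ractZr 0 e (0 : A); rewrite !scale0r.
  by have := ractZl 0 (0 : E) a; rewrite !scale0r.
have q0 : q != 0 by apply: contra_neq p0 => q0; rewrite pE q0 mul0r.
have lt_qn : (size q < n)%N by rewrite (leq_trans _ le_pn) // pE size_mul_XsubC.
set y := mulpoly a q x.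
have ya : y ** a = z *: y.
  by apply/eqP; rewrite -subr_eq0 -mulpoly_XsubC -pE px.
(* If [z] is a multiple root, then y = 0, so [q] alone already kills [x]. *)
have [qz|qz] := eqVneq q.[z] 0.
  apply: (IHn q) => //; have /factor_theorem[r qE] : root q z by apply/eqP.
  apply: (@sa_eigen_square _ _ a (mulpoly a r x) y z) => //.
  by rewrite -mulpoly_XsubC -qE.
(* For a simple root, q(a) multiplies the eigenvector [y] by q(z). Subtracting y / q(z) from [x]
   thus leaves a vector killed by [q]. *)
have x'q : mulpoly a q (x - q.[z]^-1 *: y) = 0.
  by rewrite mulpolyZB (mulpoly_eigen _ _ _ _ ya) scalerA mulVf // scale1r subrr.
have thx' := IHn q lt_qn _ q0 x'q e.
have thy : theta (e <* y <* a) = theta (e <* y) <* a.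
  by apply: (@local_eigen _ _ z); rewrite -ractA ya ractZr.
rewrite -[x](subrK (q.[z]^-1 *: y)) ractDr ractDl !linearD ractDl thx'.
by rewrite ractZr ractZl !linearZ ractZl thy.
Qed.

End LocalMap.

Theorem corollary4p9 (R : realType) (A : cstarAlgType R)
    (fdA : finite_dimensional A)
    (E F : banachRightModType A)
    (unitalE : unital_module E) (unitalF : unital_module F)
    (theta : {linear E -> F}) (localtheta : is_local theta) :
  module_map theta.
Proof.
have [u idu uE] := unitalE; have [u' idu' uF] := unitalF.
(* The two modules come with their own identities of [A], which must coincide. *)
rewrite (is_identity_uniq _ _ idu' idu) {u' idu'} in uF.
have sa_theta (a : A) (e : E) :
    star a = a -> theta (e <* a) = theta e <* a.
  (* Starting from the identity reaches every [e], as e u = e. *)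
  move=> saa; have [p p0 pu] := mulpoly_annihilator fdA a u.
  by have := local_mulpoly _ _ localtheta uE uF _ saa _ _ p0 pu e; rewrite uE.
move=> e a; have [c [d [b1 [b2 [sb1 sb2 ->]]]]] := cartesian_decomposition a.
by rewrite !ractDr !ractZr linearD !linearZ !sa_theta.
Qed.
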